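(* If $H_{20}$ is an anti-twinned signified graph on $20$ vertices such that every signified graph whose underlying graph is planar admits a signified homomorphism to $H_{20}$, then $H_{20}$ is isomorphic (by a sign-preserving isomorphism) to $Tr(SP_9)$.
   Context: A signified graph $(G,\Sigma)$ is a simple graph $G$ with a set $\Sigma\subseteq E(G)$ of negative edges, other edges positive. A signified homomorphism is a vertex map sending every edge to an edge of the same sign. For a signified graph $(H,\Lambda)$, $AT(H,\Lambda)$ has vertex set $\{u_0,u_1:u\in V(H)\}$; for every edge $uv$ of $H$ it has edges $u_0v_0,u_1v_1$ with the sign of $uv$ and $u_0v_1,u_1v_0$ with the opposite sign; no other edges. A signified graph is anti-twinned if it is isomorphic to $AT(H,\Lambda)$ for some signified graph $(H,\Lambda)$. $SP_9$ is the complete graph on $\mathbb{F}_9$ where $xy$ is negative iff $y-x$ is a non-square in $\mathbb{F}_9$; $SP_9^+$ is $SP_9$ plus a new vertex joined by positive edges to all nine vertices; and $Tr(SP_9)=AT(SP_9^+)$ (20 vertices). *)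

(* Defs.v *)
From Stdlib Require Import Reals.
From mathcomp Require Import all_boot.

Set Implicit Arguments.
Unset Strict Implicit.
Unset Printing Implicit Defensive.

(* A signified graph on a finite vertex type V: a simple graph [adj]
   (symmetric, irreflexive) together with the set of negative edges [neg],
   a symmetric relation contained in [adj].  Edges not in [neg] are positive. *)
Definition signified (V : finType) (adj neg : rel V) : Prop :=
  [/\ symmetric adj, irreflexive adj, symmetric neg &
      (forall x y, neg x y -> adj x y)].

Definition sig_hom (V W : finType) (adjV negV : rel V) (adjW negW : rel W)
  (f : V -> W) : Prop :=
  forall x y, adjV x y -> adjW (f x) (f y) /\ negW (f x) (f y) = negV x y.

Definition sig_iso (V W : finType) (adjV negV : rel V) (adjW negW : rel W)
  (f : V -> W) : Prop :=
  bijective f /\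
  (forall x y, adjW (f x) (f y) = adjV x y /\ negW (f x) (f y) = negV x y).

(* Vertex u_a is encoded as (u, a) with a : bool (u_0 = (u,false),
   u_1 = (u,true)).  u_a v_b is an edge iff uv is; its sign is that of uv when
   a = b and the opposite one when a <> b. *)
Definition AT_adj (H : finType) (adjH : rel H) : rel (H * bool)%type :=
  fun p q => adjH p.1 q.1.
Definition AT_neg (H : finType) (adjH negH : rel H) : rel (H * bool)%type :=
  fun p q => adjH p.1 q.1 && (negH p.1 q.1 (+) (p.2 != q.2)).

Definition anti_twinned (V : finType) (adj neg : rel V) : Prop :=
  exists (H : finType) (adjH negH : rel H) (f : V -> (H * bool)%type),
    signified adjH negH /\
    sig_iso adj neg (AT_adj adjH) (AT_neg adjH negH) f.

(* F_9 is realised as F_3[i] with i^2 = -1 (x^2+1 is irreducible over F_3):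
   the pair (a, b) stands for a + b i, with a, b in {0,1,2}. *)
Definition F9 := ('I_3 * 'I_3)%type.

(* (p, q) (natural numbers, read mod 3) is a square in F_9:
   exists z = a + b i with z^2 = (a^2 - b^2) + 2ab i = p + q i. *)
Definition F9_is_square (p q : nat) : bool :=
  [exists z : F9,
     ((z.1 * z.1 + 2 * (z.2 * z.2)) %% 3 == p %% 3) &&
     ((2 * (z.1 * z.2)) %% 3 == q %% 3)].

(* y - x is a non-square in F_9 (computing -x as 2x mod 3). *)
Definition F9_diff_nonsquare (x y : F9) : bool :=
  ~~ F9_is_square (y.1 + 2 * x.1) (y.2 + 2 * x.2).

Definition SP9_adj : rel F9 := fun x y => x != y.
Definition SP9_neg : rel F9 := fun x y => (x != y) && F9_diff_nonsquare x y.

Definition SP9p_adj : rel (option F9) := fun x y => x != y.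
Definition SP9p_neg : rel (option F9) := fun x y =>
  match x, y with
  | Some a, Some b => SP9_neg a b
  | _, _ => false
  end.

Definition TrSP9 := (option F9 * bool)%type.
Definition TrSP9_adj : rel TrSP9 := AT_adj SP9p_adj.
Definition TrSP9_neg : rel TrSP9 := AT_neg SP9p_adj SP9p_neg.

(* A graph is planar if it has a drawing in R^2: vertices go to distinct
   points, each edge xy to a simple arc (continuous injective image of [0,1])
   from the point of x to the point of y, whose interior avoids all vertex
   points, and interiors of arcs of distinct edges are disjoint.
   Arcs are given as maps R -> R^2 (coordinates ax, ay), indexed by ordered
   pairs; only their values on [0,1] matter. *)
Definition in01 (t : R) : Prop := Rle R0 t /\ Rle t R1.
Definition in01o (t : R) : Prop := Rlt R0 t /\ Rlt t R1.

Definition planar (V : finType) (adj : rel V) : Prop :=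
  exists (px py : V -> R) (ax ay : V -> V -> R -> R),
    (forall u v, px u = px v -> py u = py v -> u = v) /\
    (forall x y, adj x y ->
       ax x y R0 = px x /\ ay x y R0 = py x /\
       ax x y R1 = px y /\ ay x y R1 = py y /\
       (forall t, in01 t -> continuity_pt (ax x y) t /\
                            continuity_pt (ay x y) t) /\
       (forall s t, in01 s -> in01 t ->
          ax x y s = ax x y t -> ay x y s = ay x y t -> s = t) /\
       (forall t z, in01o t -> ~ (ax x y t = px z /\ ay x y t = py z))) /\
    (forall x y x' y', adj x y -> adj x' y' ->
       ~ ((x == x') && (y == y') || (x == y') && (y == x')) ->
       forall s t, in01o s -> in01o t ->
         ~ (ax x y s = ax x' y' t /\ ay x y s = ay x' y' t)).

(* Main.v *)
Require Import Defs.
From Stdlib Require Import Reals Lra Classical.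
From HB Require Import structures.
From mathcomp Require Import all_boot.
From mathcomp Require Import zify.

(* The target is AT(H) with |H| = 10.  Only planar graphs of one kind matter:
   triangles subdivided by repeatedly joining a new vertex to the three corners
   of a face.  Gluing enough of them along a common edge singles out a
   nonempty set of "good" edges AB of AT(H), at which all of them can be mapped.
   An arbitrarily signed path all of whose vertices are joined to A by the sign
   s and to B by the sign s' is mapped inside one of the four classes
   {C : AC has sign s, BC has sign s'}, through good edges.  Three vertices do
   not suffice to walk along +-+-, so each class has at least 4 elements; as
   there are only 16 candidates outside the two antipodal pairs, each class has
   exactly 4, and all edges are present and good.  So H is a regular two-graph
   on 10 points, the positive neighbourhood of each vertex of AT(H) is strongly
   regular with parameters (9,4,1,2), and hence it is the 3 x 3 rook graph; this
   is SP_9, as the squares of F_9 are the elements p + qi with pq = 0. *)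

Set Implicit Arguments.
Unset Strict Implicit.
Unset Printing Implicit Defensive.

(** * Signed stacked triangulations and good edges *)

(** A signed stacked triangulation of a face [A B C]: [Node] puts a vertex [X] inside, records the
    signs of [XA], [XB], [XC], and continues in the faces [X B C], [A X C], [A B X]. *)
Inductive tree :=
  Leaf | Node (sa sb sc : bool) (ta tb tc : tree).

Section Realization.

Variables (T : finType) (adj neg : rel T).

Definition signed_edge (s : bool) (A B : T) := adj A B && (neg A B == s).
Local Notation edge := signed_edge.

(** Existence of a sign-preserving map of the triangulation with prescribed images of the corners;
    the three outer edges are left free. *)
Fixpoint realizes (t : tree) (A B C : T) : bool :=
  if t is Node sa sb sc ta tb tc then
    [exists X, [&& edge sa X A, edge sb X B, edge sc X C,
       realizes ta X B C, realizes tb A X C & realizes tc A B X]]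
  else true.

Fixpoint rot (t : tree) : tree :=
  if t is Node sa sb sc ta tb tc
  then Node sc sa sb (rot tc) (rot ta) (rot tb) else Leaf.

Lemma realizes_rot t A B C : realizes (rot t) A B C = realizes t B C A.
Proof.
elim: t A B C => //= sa sb sc ta IHa tb IHb tc IHc A B C.
apply: eq_existsb => X; rewrite IHa IHb IHc.
by case: (edge sc X A) (edge sa X B) (edge sb X C) (realizes tc B C X)
   (realizes ta X C A) (realizes tb B X A) => [] [] [] [] [] [].
Qed.

(* Several trees can be drawn at the same edge: [graft t u] puts [u] in the
   last triangle at the edge [AB] of [t]. *)
Fixpoint graft (t u : tree) : tree :=
  if t is Node sa sb sc ta tb tc then Node sa sb sc ta tb (graft tc u) else u.

Lemma realizes_graft t u A B C : realizes (graft t u) A B C ->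
  realizes t A B C /\ exists D, realizes u A B D.
Proof.
elim: t A B C => /= [|sa sb sc ta _ tb _ tc IHc] A B C.
  by move=> H; split=> //; exists C.
case/existsP=> X /and5P[h1 h2 h3 h4 /andP[h5 /IHc[h6 h7]]]; split=> //.
by apply/existsP; exists X; rewrite h1 h2 h3 h4 h5 h6.
Qed.

Definition edge_universal (A B : T) := forall t sa sb,
  exists C, [&& edge sa C A, edge sb C B & realizes t A B C].

(** Each pair that is not universal is excluded by some tree and two signs. Grafting these finitely
    many obstructions along [AB] excludes all such pairs at once. *)
Lemma edge_obstruction : exists t, forall A B C,
  realizes t A B C -> edge_universal A B.
Proof.
suff [t Ht] : exists t, forall p, p \in enum {: T * T} ->
    forall C, realizes t p.1 p.2 C -> edge_universal p.1 p.2.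
  by exists t => A B C; apply: (Ht (A, B)); rewrite mem_enum.
elim: (enum _) => [|[A B] l [t IH]]; first by exists Leaf.
case: (classic (edge_universal A B)) => [good|bad].
  by exists t => p; rewrite inE => /predU1P[-> //|/IH].
have [u [sa [sb Hu]]] : exists u sa sb, forall C,
    ~ [&& edge sa C A, edge sb C B & realizes u A B C].
  apply: NNPP => N; apply: bad => u sa sb; apply: NNPP => N'.
  by apply: N; exists u, sa, sb => C HC; apply: N'; exists C.
(* The new vertex plays the third corner of the obstruction [u]; its sign towards [C] is
   arbitrary. *)
exists (Node sa sb true Leaf Leaf (graft u t)) => p.
rewrite inE => /predU1P[-> | /IH{}IH] C /=;
  case/existsP=> X /and3P[h1 h2 /andP[h3 /realizes_graft[h4 [D h5]]]].
  by case: (Hu X); rewrite h1 h2 h4.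
exact: IH h5.
Qed.

(** A path starting at [C] with sign word [w], every further vertex joined to [A] by [sa] and to [B]
    by [sb]; [tb] and [ta] fill the two faces beside each path edge. *)
Definition ladder sa sb (tb ta : tree) (w : seq bool) : tree :=
  foldr (fun s r => Node sa sb s tb ta r) Leaf w.

(* The sign word [+-+-] cannot be shortened: each word of length 3 can be walked
   along in some signified graph on three vertices. *)
Lemma alternating_walk_card (S : {set T}) c0 c1 c2 c3 c4 :
  signified adj neg ->
  [/\ c0 \in S, c1 \in S, c2 \in S, c3 \in S & c4 \in S] ->
  [/\ edge false c1 c0, edge true c2 c1, edge false c3 c2 & edge true c4 c3] ->
  4 <= #|S|.
Proof.
case=> sadj iadj sneg _ [S0 S1 S2 S3 S4].
case=> /andP[a1 /eqP n1] /andP[a2 /eqP n2] /andP[a3 /eqP n3] /andP[a4 /eqP n4].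
have adj_neq a b : adj a b -> a != b.
  by apply: contraTneq => ->; rewrite iadj.
have neg_neq a b c : neg a b = false -> neg c b = true -> c != a.
  by move=> h1 h2; apply: contraTneq isT => E; rewrite E h1 in h2.
rewrite leqNgt ltnS; apply/negP => cS.
(* Consecutive vertices differ by adjacency; [c0] and [c2] differ because their edges to [c1] have
   opposite signs. *)
have u3 : uniq [:: c0; c1; c2].
  rewrite /= !inE (eq_sym c0 c1) (eq_sym c0 c2) (eq_sym c1 c2) negb_or.
  by rewrite (adj_neq _ _ a1) (adj_neq _ _ a2) (neg_neq c0 c1 c2) // sneg.
have ES : [set x in [:: c0; c1; c2]] = S.
  apply/eqP; rewrite eqEcard cardsE (card_uniqP u3) /= cS andbT.
  by apply/subsetP => y; rewrite !inE => /or3P[] /eqP->.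
(* Adjacency and signs leave only [c3 = c0], after which no value remains for [c4]. *)
move: S3 S4; rewrite -ES !inE => /or3P[] /eqP E3; first last.
- by move: (adj_neq _ _ a3); rewrite E3 eqxx.
- by move: n3; rewrite E3 sneg n2.
move=> /or3P[] /eqP E4; subst.
- by move: (adj_neq _ _ a4); rewrite eqxx.
- by rewrite n1 in n4.
- by rewrite sneg n3 in n4.
Qed.

Lemma universal_edges : signified adj neg ->
  (forall t, exists A B C, realizes t A B C) ->
  exists good : rel T,
    (exists A B, good A B) /\
    forall A B sa sb, good A B ->
      4 <= #|[set C | [&& edge sa C A, edge sb C B, good B C & good C A]]|.
Proof.
move=> sig real; have [t Ht] := edge_obstruction.
exists (fun A B => [exists C, realizes t A B C]); split.
  by have [A [B [C h]]] := real t; exists A, B; apply/existsP; exists C.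
move=> A B sa sb /existsP[C0 /Ht univ].
(* The rotations lay the first edge of [t] on [B C] and on [C A], so that these edges become good at
   every vertex [C] of the ladder that has a successor. *)
pose tb := rot t; pose ta := rot (rot t).
have step s w C : realizes (ladder sa sb tb ta (s :: w)) A B C ->
  exists2 D, edge s D C & [/\ edge sa D A, edge sb D B,
     [exists E, realizes t B C E], [exists E, realizes t C A E]
     & realizes (ladder sa sb tb ta w) A B D].
  case/existsP => D /and5P[h1 h2 h3 h4 /andP[h5 h6]]; exists D => //; split=> //.
  + by apply/existsP; exists D; rewrite -realizes_rot.
  + by apply/existsP; exists D; rewrite -realizes_rot -realizes_rot.
(* The fifth letter, of arbitrary sign, is there so that copies of [t] also hang at the edges of
   [c4]. *)
case: (univ (ladder sa sb tb ta [:: false; true; false; true; true]) sa sb).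
move=> c0 /and3P[p0 q0 /step[c1 e1 [p1 q1 g0 g0' /step[c2 e2]]]].
case=> p2 q2 g1 g1' /step[c3 e3 [p3 q3 g2 g2' /step[c4 e4]]].
case=> p4 q4 g3 g3' /step[c5 _ [_ _ g4 g4' _]].
apply: (@alternating_walk_card _ c0 c1 c2 c3 c4) => //.
rewrite !inE; split; apply/and4P; split; assumption.
Qed.

End Realization.

(** * Regularity of the target *)

Lemma card_sum (T : finType) (P : pred T) : #|[set x | P x]| = \sum_x (P x : nat).
Proof.
rewrite cardsE -sum1_card big_mkcond.
by apply: eq_bigr => x _; rewrite unfold_in; case: (P x).
Qed.

Lemma sum_pred1 (T : finType) (a : T) : \sum_x ((x == a) : nat) = 1.
Proof.
rewrite -card_sum -[RHS](cards1 a); apply: eq_card => x.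
by rewrite !inE.
Qed.

Section TwoGraph.

Variables (H : finType) (adjH negH : rel H).
Hypothesis sigH : signified adjH negH.

Local Notation T := (H * bool)%type.
Local Notation adj := (AT_adj adjH).
Local Notation neg := (AT_neg adjH negH).
Local Notation edge := (signed_edge adj neg).

Definition anti (A : T) : T := (A.1, ~~ A.2).

Lemma AT_signified : signified adj neg.
Proof.
case: sigH => s i sn sub; split.
- by move=> A B; rewrite /AT_adj s.
- by move=> A; rewrite /AT_adj i.
- by move=> A B; rewrite /AT_neg s sn (eq_sym A.2).
- by move=> A B /andP[].
Qed.

Lemma edgeC s A B : edge s A B = edge s B A.
Proof.
by case: AT_signified => sa _ sn _; rewrite /signed_edge sa sn.
Qed.

Lemma edge_antil s A B : edge s (anti A) B = edge (~~ s) A B.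
Proof.
rewrite /signed_edge /AT_neg /AT_adj /=.
by case: (adjH _ _) (negH _ _) A.2 B.2 s => [] [] [] [] [].
Qed.

Lemma edge_antir s A B : edge s A (anti B) = edge (~~ s) A B.
Proof. by rewrite edgeC edge_antil edgeC. Qed.

Lemma edge_uniq s s' A B : edge s A B -> edge s' A B -> s = s'.
Proof. by move=> /andP[_ /eqP <-] /andP[_ /eqP <-]. Qed.

Lemma edge_fst s A B : edge s A B -> A.1 != B.1.
Proof.
case: sigH => _ i _ _ /andP[h _].
by apply: contraTneq h; rewrite /AT_adj => ->; rewrite i.
Qed.

Lemma edge_adj A B : adj A B = edge false A B || edge true A B.
Proof. by rewrite /signed_edge; case: (adj A B) (neg A B) => [] []. Qed.

Lemma sum_edges A B : (edge false A B : nat) + edge true A B = adj A B.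
Proof. by rewrite /signed_edge; case: (adj A B) (neg A B) => [] []. Qed.

Lemma same_fst (A B : T) : A.1 = B.1 -> A = B \/ A = anti B.
Proof.
case: A B => [a i] [b j] /= ->; rewrite /anti /=.
by case: i j => [] []; auto.
Qed.

Definition cell (A B : T) sa sb := [set C | edge sa A C && edge sb B C].

(** For ten points this says that [H] is complete and that its switching class is a regular
    two-graph, read off in the double cover. *)
Definition regular := forall A B : T, A.1 != B.1 ->
  adj A B /\ forall sa sb, #|cell A B sa sb| = 4.

(** * Counting common neighbours of three vertices *)

Definition triple (A B C : T) sa sb sc :=
  #|[set D | [&& edge sa A D, edge sb B D & edge sc C D]]|.

(** The involution [anti] reverses all three signs. *)
Lemma triple_anti A B C sa sb sc :
  triple A B C sa sb sc = triple A B C (~~ sa) (~~ sb) (~~ sc).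
Proof.
have antiK : involutive anti by case=> h b; rewrite /anti /= negbK.
rewrite /triple -(card_imset _ (inv_inj antiK)).
apply: eq_card => D; rewrite inE; apply/imsetP/idP.
  case=> E; rewrite inE => h ->.
  by rewrite !edge_antir !negbK.
move=> hD; exists (anti D); last by rewrite antiK.
by rewrite inE !edge_antir.
Qed.

Lemma tripleC A B C sa sb sc : triple A B C sa sb sc = triple A C B sa sc sb.
Proof.
by apply: eq_card => D; rewrite !inE; congr (_ && _); rewrite andbC.
Qed.

Lemma triple_rot A B C sa sb sc : triple A B C sa sb sc = triple B C A sb sc sa.
Proof.
by apply: eq_card => D; rewrite !inE [RHS]andbA [RHS]andbC.
Qed.

(* The two correction terms are the contributions of [C] and of [anti C]. *)
Lemma cell_triple A B C x y z sa sb : regular ->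
  edge x A C -> edge y B C -> edge z A B ->
  triple A B C sa sb false + triple A B C sa sb true
  + ((sa == x) && (sb == y)) + ((sa == ~~ x) && (sb == ~~ y)) = 4.
Proof.
move=> reg eA eB eAB; have [_ /(_ sa sb) <-] := reg A B (edge_fst eAB).
(* A correction term is spread as a sum supported at one vertex, so that the identity can be checked
   vertex by vertex. *)
have scal (b : bool) (D : T) : (b : nat) = \sum_E ((E == D) && b : nat).
  case: b.
    by apply: etrans (esym (sum_pred1 D)) _; apply: eq_bigr => E _; rewrite andbT.
  by rewrite big1 // => E _; rewrite andbF.
rewrite (scal ((sa == x) && _) C) (scal ((sa == ~~ x) && _) (anti C)).
rewrite /triple /cell !card_sum -!big_split; apply: eq_bigr => D _ /=.
(* Away from [C] and [anti C], exactly one sign occurs on [CD]. At these two vertices the triple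
   terms vanish, and membership in the cell is the correction term. *)
have [DC|DC] := eqVneq D.1 C.1; last first.
  have [|CD _] := reg C D; first by rewrite eq_sym.
  have := sum_edges C D; rewrite CD.
  have /negbTE -> : D != C by apply: contraNneq DC => ->.
  have /negbTE -> : D != anti C by apply: contraNneq DC => ->.
  case: (edge sa A D) (edge sb B D) (edge false C D) (edge true C D)
     => [] [] [] [] //.
have nC s : edge s C D = false.
  by apply: contra_eqF DC => /edge_fst; rewrite eq_sym.
have e1 s u A' : edge u A' C -> edge s A' C = (s == u).
  by move=> h; apply/idP/eqP => [/edge_uniq /(_ h)|->].
rewrite !nC !andbF !add0n.
have nanti : anti C != C by case: (C) => h b; rewrite /anti xpair_eqE eqxx; case: b.
case: (same_fst DC) => ->; rewrite eqxx ?(negbTE nanti) ?[C == _]eq_sym ?(negbTE nanti) /=.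
  by rewrite (e1 _ _ _ eA) (e1 _ _ _ eB) addn0.
rewrite !edge_antir (e1 _ _ _ eA) (e1 _ _ _ eB).
by clear; case: sa x sb y => [] [] [] [].
Qed.

(** Up to [anti] there are four unknown counts, and four of the cell equations determine them. The
    values are the parameters 1 and 2 of the strongly regular positive neighbourhood of [A]. *)
Lemma triple_card A B C s : regular ->
  edge false A B -> edge false A C -> edge s B C ->
  triple A B C false false false = if s then 2 else 1.
Proof.
move=> reg AB AC BC.
have e1 sa sb := cell_triple sa sb reg AC BC AB.
have e2 sa sb : triple A B C sa false sb + triple A B C sa true sb
  + ((sa == false) && (sb == s)) + ((sa == ~~ false) && (sb == ~~ s)) = 4.
  by rewrite !(tripleC A B); apply: cell_triple reg AB _ AC; rewrite edgeC.
have e3 sa sb : triple A B C false sa sb + triple A B C true sa sb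
  + ((sa == false) && (sb == false)) + ((sa == ~~ false) && (sb == ~~ false)) = 4.
  by rewrite !(triple_rot A B); apply: cell_triple reg _ _ BC; rewrite edgeC.
have := e1 false false; have := e1 false true; have := e2 false false.
have := e3 false false; rewrite (triple_anti A B C false true true).
by rewrite (triple_anti A B C true false false) /=; case: s {AB AC BC e1 e2 e3} => /=; lia.
Qed.

Hypothesis cardH : #|H| = 10.

Lemma fresh_vertex (A B C : T) : exists D : T, [/\ D.1 != A.1, D.1 != B.1 & D.1 != C.1].
Proof.
have /card_gt0P[d] : 0 < #|~: [set A.1; B.1; C.1]|.
  have := cardsC [set A.1; B.1; C.1].
  have := (leq_card_setU [set A.1; B.1] [set C.1]).1.
  by rewrite cards1 cards2 cardH; case: (_ == _) => /=; lia.
rewrite !inE !negb_or -andbA => /and3P[a b c].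
by exists (d, true).
Qed.

Lemma card_outside (A B : T) : A.1 != B.1 ->
  #|[set C : T | (C.1 != A.1) && (C.1 != B.1)]| = 16.
Proof.
move=> AB.
have -> : [set C : T | (C.1 != A.1) && (C.1 != B.1)]
        = setX (~: [set A.1; B.1]) [set: bool].
  by apply/setP => C; rewrite !inE negb_or andbT.
rewrite cardsX cardsT card_bool.
by have := cardsC [set A.1; B.1]; rewrite cards2 AB cardH; lia.
Qed.

(** * Goodness spreads to all pairs *)

Section Good.

Variable good : rel T.
Hypothesis good_cell : forall A B sa sb, good A B ->
  4 <= #|[set C | [&& edge sa C A, edge sb C B, good B C & good C A]]|.

(** If [B] is [A] or [anti A], the sign of [CA] determines that of [CB], so one of the four classes
    is empty. *)
Lemma good_fst A B : good A B -> A.1 != B.1.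
Proof.
move=> gAB; apply/eqP => /esym /same_fst E.
have [s Es] : exists s, forall C, edge s C B = edge true C A.
  case: E => ->; [by exists true | exists false => C].
  by rewrite edge_antir.
have := good_cell false s gAB; rewrite leqNgt => /negP; apply.
rewrite (_ : [set _ | _] = set0) ?cards0 //.
apply/setP => C; rewrite !inE Es; apply/negP => /and4P[h1 h2 _ _].
by have := edge_uniq h1 h2.
Qed.

Lemma sum_cells (P : rel T) (A B : T) :
  (forall sa sb, 4 <= #|[set C | [&& edge sa C A, edge sb C B & P A C]]|) ->
  16 <= #|[set C | [&& adj C A, adj C B & P A C]]|.
Proof.
move=> h4; rewrite card_sum.
rewrite (eq_bigr (fun C =>
   ([&& edge false C A, edge false C B & P A C] : nat)
  + [&& edge false C A, edge true C B & P A C]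
  + [&& edge true C A, edge false C B & P A C]
  + [&& edge true C A, edge true C B & P A C])); last first.
  move=> C _; rewrite /signed_edge.
  by case: (adj C A) (adj C B) (neg C A) (neg C B) (P A C) => [] [] [] [] [].
rewrite !big_split /= -!card_sum.
have := h4 false false; have := h4 false true.
by have := h4 true false; have := h4 true true; lia.
Qed.

(** The four classes supply 16 vertices, which are all the candidates outside the two antipodal
    pairs. *)
Lemma good_outside A B C : good A B -> C.1 != A.1 -> C.1 != B.1 ->
  [/\ adj C A, adj C B, good B C & good C A].
Proof.
move=> gAB CA CB; have AB := good_fst gAB.
have h : 16 <= #|[set C | [&& adj C A, adj C B & good B C && good C A]]|.
  by apply: (@sum_cells (fun _ C => good B C && good C A)) => sa sb; apply: good_cell.
have sub : [set C | [&& adj C A, adj C B & good B C && good C A]]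
    \subset [set C : T | (C.1 != A.1) && (C.1 != B.1)].
  apply/subsetP => D; rewrite !inE !edge_adj => /and3P[/orP h1 /orP h2 _].
  by apply/andP; split; [case: h1 | case: h2] => /edge_fst.
have /eqP E : [set C | [&& adj C A, adj C B & good B C && good C A]]
    == [set C : T | (C.1 != A.1) && (C.1 != B.1)].
  by rewrite eqEcard sub card_outside.
have : C \in [set C : T | (C.1 != A.1) && (C.1 != B.1)] by rewrite inE CA.
by rewrite -E inE => /and4P[].
Qed.

(** [good] is oriented: [A B] yields [B C] and [C A]. The detour through [D] and [E] gives the
    orientation [B F] and allows [F] to lie over [A]. *)
Lemma good_next A B F : good A B -> F.1 != B.1 -> good B F.
Proof.
move=> gAB FB; have AB := good_fst gAB.
have [D [DA DB DF]] := fresh_vertex A B F.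
have [_ _ gBD _] := good_outside gAB DA DB.
have [E [EB ED EF]] := fresh_vertex B D F.
have [_ _ _ gEB] := good_outside gBD EB ED.
by have [] := good_outside gEB _ FB; rewrite // eq_sym.
Qed.

Lemma good_all A0 B0 A B : good A0 B0 -> A.1 != B.1 -> good A B.
Proof.
move=> g0 AB; have [D [DB0 DA _]] := fresh_vertex B0 A A.
by apply: good_next (good_next (good_next g0 DB0) _) _; rewrite eq_sym.
Qed.

Lemma adj_all A0 B0 A B : good A0 B0 -> A.1 != B.1 -> adj A B.
Proof.
move=> g0 AB; have [D [DA DB _]] := fresh_vertex A B B.
have gBD : good B D by apply: good_all g0 _; rewrite eq_sym.
by have [] := good_outside gBD AB _; rewrite // eq_sym.
Qed.

(** Four disjoint classes of size at least 4 lie among 16 candidates. *)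
Lemma cell_card (A0 B0 A B : T) sa sb : good A0 B0 -> A.1 != B.1 ->
  #|cell A B sa sb| = 4.
Proof.
move=> g0 AB; have gAB : good A B by apply: good_all g0 _.
have h4 s t : 4 <= #|cell A B s t|.
  apply: leq_trans (good_cell s t gAB) _; apply: subset_leq_card.
  by apply/subsetP => C; rewrite !inE -!(edgeC _ C) => /and4P[-> ->].
have : #|cell A B false false| + #|cell A B false true|
     + #|cell A B true false| + #|cell A B true true| <= 16.
  rewrite -(card_outside AB) /cell !card_sum -!big_split /=.
  apply: leq_sum => C _.
  have eA : adj A C -> C.1 != A.1.
    by rewrite edge_adj eq_sym => /orP[] /edge_fst.
  have eB : adj B C -> C.1 != B.1.
    by rewrite edge_adj eq_sym => /orP[] /edge_fst.
  rewrite /signed_edge.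
  by case: (adj A C) eA (adj B C) eB (neg A C) (neg B C)
    => [/(_ isT) -> |_] [/(_ isT) -> |_] [] [].
have := h4 false false; have := h4 false true.
by have := h4 true false; have := h4 true true; case: sa; case: sb; lia.
Qed.

End Good.

End TwoGraph.

(** * The positive neighbourhood of a vertex *)

Lemma card4_mem (T : finType) (S : {set T}) (s : seq T) (D : T) :
  #|S| = size s -> uniq s -> {subset s <= S} -> D \in S -> D \in s.
Proof.
move=> cS us sub DS.
have /eqP E : [set x in s] == S.
  rewrite eqEcard cardsE (card_uniqP us) cS leqnn andbT.
  by apply/subsetP => x; rewrite inE => /sub.
by move: DS; rewrite -E inE.
Qed.

Section Grid.

Variables (H : finType) (adjH negH : rel H).
Hypothesis sigH : signified adjH negH.
Hypothesis cardH : #|H| = 10.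

Local Notation T := (H * bool)%type.
Local Notation adj := (AT_adj adjH).
Local Notation neg := (AT_neg adjH negH).
Local Notation edge := (signed_edge adj neg).

Hypothesis reg : regular adjH negH.

Variable A0 : T.
Local Notation P D := (edge false A0 D).

Lemma edge_xx s (A : T) : edge s A A = false.
Proof. by apply/negP => /(edge_fst sigH); rewrite eqxx. Qed.

(** In the graph of positive edges on the positive neighbourhood of [A0], each edge lies in exactly
    one triangle; these triangles will be the lines of the grid. *)
Lemma common_uniq (B C D E : T) : P B -> P C -> edge false B C ->
  P D -> edge false B D -> edge false C D ->
  P E -> edge false B E -> edge false C E -> D = E.
Proof.
move=> PB PC BC PD BD CD PE BE CE.
have /eqP/cards1P[F EF] := triple_card sigH reg PB PC BC.
have : D \in [set F] by rewrite -EF inE PD BD.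
have : E \in [set F] by rewrite -EF inE PE BE.
by rewrite !inE => /eqP -> /eqP.
Qed.

Lemma common_exists (B C : T) : P B -> P C -> edge false B C ->
  exists D, [/\ P D, edge false B D & edge false C D].
Proof.
move=> PB PC BC; have /eqP/cards1P[D ED] := triple_card sigH reg PB PC BC.
by exists D; apply/and3P; have := set11 D; rewrite -ED inE.
Qed.

(** Non-adjacent vertices have two common neighbours, so one of them avoids [E]. *)
Lemma common_other (B C E : T) : P B -> P C -> edge true B C ->
  exists D, [/\ D != E, P D, edge false B D & edge false C D].
Proof.
move=> PB PC BC; have c2 := triple_card sigH reg PB PC BC.
have /card_gt0P[D] : 0 < #|[set D | [&& P D, edge false B D & edge false C D]] :\ E|.
  by move: c2; rewrite /triple (cardsD1 E); case: (_ \in _); lia.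
by rewrite !inE => /and4P[*]; exists D.
Qed.

(** Antipodal vertices cannot both be positive neighbours of [A0], so distinct ones are always
    joined. *)
Lemma edge_true (D E : T) : P D -> P E -> D <> E -> ~ edge false D E ->
  edge true D E.
Proof.
move=> PD PE nDE nf.
have DE : D.1 != E.1.
  apply/eqP => /same_fst[//|ED]; move: PD; rewrite ED edge_antir //=.
  by move/(edge_uniq PE).
have [] := reg DE; rewrite (edge_adj _ negH) => /orP[/nf|->] //.
Qed.

Lemma link_card (B : T) : P B -> #|cell adjH negH A0 B false false| = 4.
Proof. by move=> /(edge_fst sigH) /reg[_ ->]. Qed.


(** Coordinates of the 3 x 3 array: [B0] is a corner, [x] and [y] complete its row and column, [z]
    gives the other four points. *)
Definition grid (B0 : T) (x y : bool -> T) (z : bool -> bool -> T)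
  (p : option bool * option bool) : T :=
  match p with
  | (None, None) => B0
  | (Some i, None) => x i
  | (None, Some j) => y j
  | (Some i, Some j) => z i j
  end.

Lemma grid_exists : exists g : option bool * option bool -> T,
  (forall p, P (g p)) /\
  (forall p q, p != q -> edge ((p.1 != q.1) && (p.2 != q.2)) (g p) (g q)).
Proof.
have eC s (D E : T) : edge s D E -> edge s E D by rewrite edgeC.
have cl (D E : T) : edge false D E -> edge true D E -> False.
  by move=> h1 h2; have := edge_uniq h1 h2.
have [B0 PB0] : exists B0, P B0.
  have [F [FA _ _]] := fresh_vertex cardH A0 A0 A0.
  have [|_ /(_ false false) c4] := reg (A := A0) (B := F); first by rewrite eq_sym.
  have /card_gt0P[B] : 0 < #|cell adjH negH A0 F false false| by rewrite c4.
  by rewrite inE => /andP[h _]; exists B.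
have L0 := link_card PB0.
have [x0] : exists D, D \in cell adjH negH A0 B0 false false.
  by apply/card_gt0P; rewrite L0.
rewrite inE => /andP[Px0 Bx0].
have [x1 [Px1 Bx1 x01]] := common_exists PB0 Px0 Bx0.
pose x (i : bool) := if i then x1 else x0.
have Px i : P (x i) by case: i.
have Bx i : edge false B0 (x i) by case: i.
have xx i : edge false (x i) (x (~~ i)) by case: i; rewrite //= edgeC.
(* The four neighbours of [B0] form two triangles with it; [y0] starts the second one. *)
have [y0] : exists D, D \in cell adjH negH A0 B0 false false :\: [set x0; x1].
  apply/card_gt0P; have := cardsD (cell adjH negH A0 B0 false false) [set x0; x1].
  have := subset_leq_card (subsetIr (cell adjH negH A0 B0 false false) [set x0; x1]).
  by rewrite L0 cards2; case: (x0 != x1) => /=; lia.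
rewrite !inE negb_or -andbA => /and4P[/eqP y0x0 /eqP y0x1 Py0 By0].
have [y1 [Py1 By1 y01]] := common_exists PB0 Py0 By0.
pose y (i : bool) := if i then y1 else y0.
have Py i : P (y i) by case: i.
have By i : edge false B0 (y i) by case: i.
have yy i : edge false (y i) (y (~~ i)) by case: i; rewrite //= edgeC.
(* A positive edge would make [y0] a second common neighbour of [B0] and [x i]. *)
have xy0 i : edge true (x i) y0.
  apply: edge_true => // [E|h]; first by case: i E => /= E; [case: y0x1|case: y0x0].
  have := common_uniq PB0 (Px i) (Bx i) (Px _) (Bx _) (xx i) Py0 By0 h.
  by case: i {h} => /= E; [case: y0x0|case: y0x1].
have xny1 i : x i <> y1.
  by move=> E; apply: cl (xy0 i); rewrite E; apply: eC.
have xy i j : edge true (x i) (y j).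
  case: j => //=; apply: edge_true => // h.
  have := common_uniq PB0 (Px i) (Bx i) (Px _) (Bx _) (xx i) Py1 By1 h.
  exact: xny1.
(* The common neighbour of [x i] and [y j] other than [B0]; the default is never taken. *)
pose z (i j : bool) : T := odflt B0
  [pick D | [&& D != B0, P D, edge false (x i) D & edge false (y j) D]].
have zP i j : [/\ z i j != B0, P (z i j), edge false (x i) (z i j) & edge false (y j) (z i j)].
  rewrite /z; case: pickP => [D /and4P //|none].
  have [D [h1 h2 h3 h4]] := common_other B0 (Px i) (Py j) (xy i j).
  by move: (none D); rewrite h1 h2 h3 h4.
have zB i j : z i j <> B0 by case: (zP i j) => /eqP.
have Pz i j : P (z i j) by case: (zP i j).
have xz i j : edge false (x i) (z i j) by case: (zP i j).
have yz i j : edge false (y j) (z i j) by case: (zP i j).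
have znx i i' j : z i j <> x i'.
  by move=> E; apply: cl (xy i' j); rewrite -E; apply: eC.
have zny i j j' : z i j <> y j'.
  by move=> E; apply: cl (xy i j'); rewrite -E.
have Bz i j : edge true B0 (z i j).
  apply: edge_true => // [/esym|h]; first exact: zB.
  apply: (znx i (~~ i) j).
  exact: common_uniq PB0 (Px i) (Bx i) (Pz i j) h (xz i j) (Px _) (Bx _) (xx i).
have x'z i j : edge true (x (~~ i)) (z i j).
  apply: edge_true => // [/esym|h]; first exact: znx.
  apply: (zB i j).
  exact: common_uniq (Px i) (Px _) (xx i) (Pz i j) (xz i j) h PB0
    (eC _ _ _ (Bx i)) (eC _ _ _ (Bx _)).
have y'z i j : edge true (y (~~ j)) (z i j).
  apply: edge_true => // [/esym|h]; first exact: zny.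
  apply: (zB i j).
  exact: common_uniq (Py j) (Py _) (yy j) (Pz i j) (yz i j) h PB0
    (eC _ _ _ (By j)) (eC _ _ _ (By _)).
have zz1 i j : z i j <> z i (~~ j).
  by move=> E; apply: cl (y'z i j); rewrite E.
have zz2 i j : z i j <> z (~~ i) j.
  by move=> E; apply: cl (x'z i j); rewrite E.
(* The line through [x i] and [z i j] has a third point among the four neighbours of [x i], and only
   [z i (~~ j)] fits. *)
have zr i j : edge false (z i j) (z i (~~ j)).
  have [D [PD xD zD]] := common_exists (Px i) (Pz i j) (xz i j).
  suff : D \in [:: B0; x (~~ i); z i j; z i (~~ j)].
    rewrite !inE => /or4P[] /eqP E; move: zD; rewrite E ?edge_xx //.
    + by move=> /eC /cl /(_ (Bz i j)).
    + by move=> /eC /cl /(_ (x'z i j)).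
  refine (@card4_mem _ _ [:: B0; x (~~ i); z i j; z i (~~ j)] D (link_card (Px i)) _ _ _); last
    by rewrite inE PD.
    rewrite /= !inE !negb_or !andbT.
    do ![apply/andP; split]; apply/eqP => //; try (move/esym; by [exact: zB|exact: znx]).
    by move=> E; move: (Bx (~~ i)); rewrite -E edge_xx.
  move=> E; rewrite !inE => /or4P[] /eqP ->; rewrite ?Px ?Pz ?PB0 ?xz ?xx //.
  exact: eC (Bx i).
have zc i j : edge false (z i j) (z (~~ i) j).
  have [D [PD yD zD]] := common_exists (Py j) (Pz i j) (yz i j).
  suff : D \in [:: B0; y (~~ j); z i j; z (~~ i) j].
    rewrite !inE => /or4P[] /eqP E; move: zD; rewrite E ?edge_xx //.
    + by move=> /eC /cl /(_ (Bz i j)).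
    + by move=> /eC /cl /(_ (y'z i j)).
  refine (@card4_mem _ _ [:: B0; y (~~ j); z i j; z (~~ i) j] D (link_card (Py j)) _ _ _); last
    by rewrite inE PD.
    rewrite /= !inE !negb_or !andbT.
    do ![apply/andP; split]; apply/eqP => //; try (move/esym; by [exact: zB|exact: zny]).
    by move=> E; move: (By (~~ j)); rewrite -E edge_xx.
  move=> E; rewrite !inE => /or4P[] /eqP ->; rewrite ?Py ?Pz ?PB0 ?yz ?yy //.
  exact: eC (By j).
have xw i j : edge true (x i) (z (~~ i) j) by rewrite -{1}[i]negbK.
have yw i j : edge true (y j) (z i (~~ j)) by rewrite -{1}[j]negbK.
(* The four neighbours of [z i j] are already known, and the opposite corner is none of them. *)
have zd i j : edge true (z i j) (z (~~ i) (~~ j)).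
  apply: edge_true => // [E|h].
    by apply: cl (xw i (~~ j)); rewrite -E.
  have : z (~~ i) (~~ j) \in [:: x i; y j; z i (~~ j); z (~~ i) j].
    refine (@card4_mem _ _ [:: x i; y j; z i (~~ j); z (~~ i) j] 
      (z (~~ i) (~~ j)) (link_card (Pz i j)) _ _ _); last
    by rewrite inE Pz.
      rewrite /= !inE !negb_or !andbT.
      do ![apply/andP; split]; apply/eqP => //; try (by move/esym; [exact: znx|exact: zny]).
      + by move=> E; move: (xy i j); rewrite -E edge_xx.
      + by move=> /esym/znx.
      + by move=> /esym/znx.
      + by move=> /esym/zny.
      + by move=> /esym/zny.
      + by move=> E; apply: cl (xw i j); rewrite -E.
    move=> E; rewrite !inE => /or4P[] /eqP ->.
    + by rewrite Px; apply: eC.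
    + by rewrite Py; apply: eC.
    + by rewrite Pz zr.
    + by rewrite Pz zc.
  rewrite !inE => /or4P[] /eqP E.
  + exact: znx E.
  + exact: zny E.
  + by apply: cl (xw i (~~ j)); rewrite E.
  + by apply: cl (yw (~~ i) j); rewrite E.
exists (grid B0 x y z); split.
  by move=> [[i|] [j|]] /=.
have neg2 (i j : bool) : i != j -> j = ~~ i by case: i j => [] [].
have hn (i : bool) : (Some i == Some (~~ i)) = false by case: i.
move=> [[i|] [j|]] [[i'|] [j'|]]; rewrite ?xpair_eqE /fst /snd;
  try (have [<-|/neg2 ->] := eqVneq i i'); try (have [<-|/neg2 ->] := eqVneq j j');
  rewrite ?eqxx ?hn => // _;
  first [exact: xx | exact: yy | exact: zr | exact: zc | exact: zd | exact: xy
    | exact: xz | exact: yz | exact: x'z | exact: y'z | exact: xw | exact: yw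
    | exact: Bx | exact: By | exact: Bz | apply: eC;
    first [exact: xy | exact: xz | exact: yz | exact: x'z | exact: y'z
    | exact: xw | exact: yw | exact: Bx | exact: By | exact: Bz]].
Qed.
End Grid.

(** * Recognising [SP_9] and its double cover *)

Lemma F9_is_squareE p q : F9_is_square p q = (p %% 3 == 0) || (q %% 3 == 0).
Proof.
apply/existsP/idP => [[[[[|[|[|//]]] a] [[|[|[|//]]] b]]] /= /andP[/eqP <- /eqP <-] //|].
have w (i j : nat) (hi : i < 3) (hj : j < 3) :
    (i * i + 2 * (j * j)) %% 3 == p %% 3 -> (2 * (i * j)) %% 3 == q %% 3 ->
    exists z : F9, ((z.1 * z.1 + 2 * (z.2 * z.2)) %% 3 == p %% 3) &&
     ((2 * (z.1 * z.2)) %% 3 == q %% 3).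
  by move=> h1 h2; exists (Ordinal hi, Ordinal hj); rewrite /= h1 h2.
have : p %% 3 < 3 by rewrite ltn_mod.
have : q %% 3 < 3 by rewrite ltn_mod.
case: (p %% 3) w => [|[|[|//]]]; case: (q %% 3) => [|[|[|//]]] w //= _ _ _.
(* Square roots of 0, i, -i, 1 and -1, in this order. *)
- exact: (w 0 0).
- exact: (w 1 2).
- exact: (w 1 1).
- exact: (w 1 0).
- exact: (w 0 1).
Qed.

Lemma SP9_negE x y : SP9_neg x y = (x.1 != y.1) && (x.2 != y.2).
Proof.
case: x y => [[[|[|[|//]]] a] [[|[|[|//]]] b]] [[[|[|[|//]]] c] [[|[|[|//]]] d]];
  rewrite /SP9_neg /F9_diff_nonsquare F9_is_squareE xpair_eqE -!val_eqE //.
Qed.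

Definition coord (i : 'I_3) : option bool :=
  if val i is k.+1 then Some (k == 1) else None.

Lemma coord_inj : injective coord.
Proof.
by move=> [[|[|[|//]]] a] [[|[|[|//]]] b] //= _; apply: val_inj.
Qed.

Lemma edge_anti_pow (H : finType) (adjH negH : rel H) s (A B : H * bool) (a b : bool) :
  signified adjH negH -> signed_edge (AT_adj adjH) (AT_neg adjH negH) s A B ->
  signed_edge (AT_adj adjH) (AT_neg adjH negH) (s (+) (a != b))
    (if a then anti A else A) (if b then anti B else B).
Proof.
move=> sig; case: s; case: a; case: b => h;
  rewrite /= ?edge_antil ?(edge_antir sig); exact: h.
Qed.

Lemma regular_iso (H : finType) (adjH negH : rel H) :
  signified adjH negH -> #|H| = 10 -> regular adjH negH ->
  exists f : (H * bool)%type -> TrSP9,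
    sig_iso (AT_adj adjH) (AT_neg adjH negH) TrSP9_adj TrSP9_neg f.
Proof.
move=> sig cH reg; have /card_gt0P[h0 _] : 0 < #|H| by rewrite cH.
pose A0 : H * bool := (h0, false).
have [g [Pg Eg]] := grid_exists sig cH reg A0.
(* [A0] plays the vertex added to [SP_9], and the grid in its positive neighbourhood plays the
   field. *)
pose c (o : option F9) := if o is Some p then g (coord p.1, coord p.2) else A0.
have cE o o' : o != o' ->
    signed_edge (AT_adj adjH) (AT_neg adjH negH) (SP9p_neg o o') (c o) (c o').
  case: o o' => [p|] [q|] //= pq; last by rewrite (edgeC sig).
  rewrite SP9_negE -!(inj_eq coord_inj).
  apply: (Eg (coord p.1, coord p.2) (coord q.1, coord q.2)).
  case: p q pq => [a b] [a' b']; rewrite /= !xpair_eqE.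
  by rewrite !(inj_eq coord_inj) => pq; apply: contraNN pq.
pose phi (u : TrSP9) := if u.2 then anti (c u.1) else c u.1.
have phiE u v : u.1 != v.1 -> signed_edge (AT_adj adjH) (AT_neg adjH negH)
    (SP9p_neg u.1 v.1 (+) (u.2 != v.2)) (phi u) (phi v).
  by move=> uv; apply: edge_anti_pow => //; apply: cE.
have phi_fst u v : u.1 = v.1 -> (phi u).1 = (phi v).1.
  by rewrite /phi => ->; case: u.2; case: v.2.
have irr : irreflexive adjH by case: sig.
have phiH u v : AT_adj adjH (phi u) (phi v) = TrSP9_adj u v
    /\ AT_neg adjH negH (phi u) (phi v) = TrSP9_neg u v.
  rewrite /TrSP9_adj /TrSP9_neg; have [uv|nuv] := eqVneq u.1 v.1.
    by rewrite /AT_neg /AT_adj /SP9p_adj (phi_fst _ _ uv) irr uv eqxx.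
  have /andP[-> /eqP ->] := phiE _ _ nuv.
  by rewrite /AT_neg /AT_adj /SP9p_adj nuv.
(* In the double cover, non-adjacency means lying over the same point, so equal images force equal
   first components. *)
have phi_inj : injective phi.
  move=> u v E; have [] := phiH u v.
  rewrite E /TrSP9_adj /AT_adj irr /SP9p_adj => /esym/negbFE/eqP uv _.
  case: u v E uv => [o a] [o' b] E /= uv; subst o'; congr pair.
  move: E; rewrite /phi /=; case: a b => [] [] //; case: (c o) => h d [] ;
    by case: d.
have phi_bij : bijective phi.
  apply: inj_card_bij phi_inj _.
  by rewrite !card_prod cH card_bool card_option card_prod card_ord.
have [f fK phiK] := phi_bij.
exists f; split; first by exists phi.
by move=> u v; have [] := phiH (f u) (f v); rewrite !phiK => -> ->.
Qed.

(** * Straight-line drawings *)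

(** Decidable equality of reals makes membership in lists of points available. *)
Definition eqR (x y : R) : bool := if Req_EM_T x y then true else false.

Lemma eqRP : Equality.axiom eqR.
Proof. by move=> x y; rewrite /eqR; case: Req_EM_T => h; constructor. Qed.

HB.instance Definition _ := hasDecEq.Build R eqRP.

Section StackedTriangulation.

Local Open Scope R_scope.

Definition point := (R * R)%type.

(* Twice the signed area of the triangle [PQS]; replacing one corner by [z]
   gives the unnormalised barycentric coordinates of [z]. *)
Definition area (P Q S : point) : R :=
  (Q.1 - P.1) * (S.2 - P.2) - (Q.2 - P.2) * (S.1 - P.1).

Definition in_triangle (P Q S z : point) : Prop :=
  [/\ 0 < area z Q S, 0 < area P z S & 0 < area P Q z].

Definition segment (P Q : point) (t : R) : point :=
  (P.1 + t * (Q.1 - P.1), P.2 + t * (Q.2 - P.2)).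

Definition on_edge (e : point * point * bool) (z : point) : Prop :=
  exists2 t, in01o t & z = segment e.1.1 e.1.2 t.

Definition centroid (P Q S : point) : point :=
  ((P.1 + Q.1 + S.1) / 3, (P.2 + Q.2 + S.2) / 3).

(** Every new vertex goes to the centroid of its face; the outer corners are not listed. *)
Fixpoint tree_points (t : tree) (P Q S : point) : seq point :=
  if t is Node _ _ _ ta tb tc then
    let x := centroid P Q S in
    x :: tree_points ta x Q S ++ tree_points tb P x S ++ tree_points tc P Q x
  else [::].

Fixpoint tree_edges (t : tree) (P Q S : point) : seq (point * point * bool) :=
  if t is Node sa sb sc ta tb tc then
    let x := centroid P Q S in
    [:: (x, P, sa), (x, Q, sb), (x, S, sc) &
      tree_edges ta x Q S ++ tree_edges tb P x S ++ tree_edges tc P Q x]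
  else [::].

Section Centroid.

Variables P Q S : point.
Let x := centroid P Q S.

Lemma area_centroid :
  [/\ area x Q S = area P Q S / 3, area P x S = area P Q S / 3
    & area P Q x = area P Q S / 3].
Proof. by rewrite /x /centroid /area /=; split; field. Qed.

(** An area with corner [x] is a third of a difference of two areas of the big triangle, so the
    small triangle is where one coordinate is least. *)
Lemma in_triangle_a z : in_triangle x Q S z ->
  [/\ 0 < area z Q S, area z Q S < area P z S & area z Q S < area P Q z].
Proof.
move=> [h1 h2 h3]; split=> //.
- suff : area x z S = (area P z S - area z Q S) / 3 by lra.
  by rewrite /x /centroid /area /=; field.
- suff : area x Q z = (area P Q z - area z Q S) / 3 by lra.
  by rewrite /x /centroid /area /=; field.
Qed.

Lemma in_triangle_b z : in_triangle P x S z ->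
  [/\ 0 < area P z S, area P z S < area z Q S & area P z S < area P Q z].
Proof.
move=> [h1 h2 h3]; split=> //.
- suff : area z x S = (area z Q S - area P z S) / 3 by lra.
  by rewrite /x /centroid /area /=; field.
- suff : area P x z = (area P Q z - area P z S) / 3 by lra.
  by rewrite /x /centroid /area /=; field.
Qed.

Lemma in_triangle_c z : in_triangle P Q x z ->
  [/\ 0 < area P Q z, area P Q z < area z Q S & area P Q z < area P z S].
Proof.
move=> [h1 h2 h3]; split=> //.
- suff : area z Q x = (area z Q S - area P Q z) / 3 by lra.
  by rewrite /x /centroid /area /=; field.
- suff : area P z x = (area P z S - area P Q z) / 3 by lra.
  by rewrite /x /centroid /area /=; field.
Qed.

Hypothesis PQS : 0 < area P Q S.

(** Along this edge two coordinates are equal and shrink in proportion to [1 - t], while the third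
    grows. *)
Lemma on_edge_a s z : on_edge (x, P, s) z ->
  [/\ 0 < area P z S, area P z S < area z Q S & area P z S = area P Q z].
Proof.
case=> t [t0 t1] -> /=.
have [-> ->] : area P (segment x P t) S = (1 - t) * (area P Q S / 3)
    /\ area P Q (segment x P t) = (1 - t) * (area P Q S / 3).
  by rewrite /x /segment /centroid /area /=; split; field.
have -> : area (segment x P t) Q S = (1 + 2 * t) * (area P Q S / 3).
  by rewrite /x /segment /centroid /area /=; field.
split=> //; nra.
Qed.

Lemma on_edge_b s z : on_edge (x, Q, s) z ->
  [/\ 0 < area z Q S, area z Q S < area P z S & area z Q S = area P Q z].
Proof.
case=> t [t0 t1] -> /=.
have [-> ->] : area (segment x Q t) Q S = (1 - t) * (area P Q S / 3)
    /\ area P Q (segment x Q t) = (1 - t) * (area P Q S / 3).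
  by rewrite /x /segment /centroid /area /=; split; field.
have -> : area P (segment x Q t) S = (1 + 2 * t) * (area P Q S / 3).
  by rewrite /x /segment /centroid /area /=; field.
split=> //; nra.
Qed.

Lemma on_edge_c s z : on_edge (x, S, s) z ->
  [/\ 0 < area z Q S, area z Q S < area P Q z & area z Q S = area P z S].
Proof.
case=> t [t0 t1] -> /=.
have [-> ->] : area (segment x S t) Q S = (1 - t) * (area P Q S / 3)
    /\ area P (segment x S t) S = (1 - t) * (area P Q S / 3).
  by rewrite /x /segment /centroid /area /=; split; field.
have -> : area P Q (segment x S t) = (1 + 2 * t) * (area P Q S / 3).
  by rewrite /x /segment /centroid /area /=; field.
split=> //; nra.
Qed.

End Centroid.

Lemma corners_outside P Q S z :
  z \in [:: P; Q; S] -> ~ in_triangle P Q S z.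
Proof.
by rewrite !inE => /or3P[] /eqP -> [h1 h2 h3]; move: h1 h2 h3; rewrite /area; nra.
Qed.

Lemma tree_points_in t P Q S z : 0 < area P Q S ->
  z \in tree_points t P Q S -> in_triangle P Q S z.
Proof.
elim: t P Q S => //= sa sb sc ta IHa tb IHb tc IHc P Q S PQS.
have [ea eb ec] := area_centroid P Q S.
rewrite inE !mem_cat => /predU1P[->|/or3P[/IHa|/IHb|/IHc]].
- by split; lra.
- by case/(_ _)/in_triangle_a => [|h1 h2 h3]; [lra | split; lra].
- by case/(_ _)/in_triangle_b => [|h1 h2 h3]; [lra | split; lra].
- by case/(_ _)/in_triangle_c => [|h1 h2 h3]; [lra | split; lra].
Qed.

Lemma tree_edges_in t P Q S e z : 0 < area P Q S ->
  e \in tree_edges t P Q S -> on_edge e z -> in_triangle P Q S z.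
Proof.
elim: t P Q S => //= sa sb sc ta IHa tb IHb tc IHc P Q S PQS.
have [ea eb ec] := area_centroid P Q S.
rewrite !inE !mem_cat; case/predU1P => [->|].
  by case/on_edge_a => // *; split; lra.
case/predU1P => [->|].
  by case/on_edge_b => // *; split; lra.
case/predU1P => [->|].
  by case/on_edge_c => // *; split; lra.
case/or3P => [/IHa|/IHb|/IHc] h /h{h}.
- by case/(_ _)/in_triangle_a => [|h1 h2 h3]; [lra | split; lra].
- by case/(_ _)/in_triangle_b => [|h1 h2 h3]; [lra | split; lra].
- by case/(_ _)/in_triangle_c => [|h1 h2 h3]; [lra | split; lra].
Qed.

(* The centroid, the three edges at it and the three small triangles are told
   apart by which barycentric coordinates are least. *)
Variant zone (P Q S : point) (z : point) : nat -> Prop :=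
  | Zone_a : 0 < area P z S -> area P z S < area z Q S ->
      area P z S = area P Q z -> zone P Q S z 0
  | Zone_b : 0 < area z Q S -> area z Q S < area P z S ->
      area z Q S = area P Q z -> zone P Q S z 1
  | Zone_c : 0 < area z Q S -> area z Q S < area P Q z ->
      area z Q S = area P z S -> zone P Q S z 2
  | Zone_ta : 0 < area z Q S -> area z Q S < area P z S ->
      area z Q S < area P Q z -> zone P Q S z 3
  | Zone_tb : 0 < area P z S -> area P z S < area z Q S ->
      area P z S < area P Q z -> zone P Q S z 4
  | Zone_tc : 0 < area P Q z -> area P Q z < area z Q S ->
      area P Q z < area P z S -> zone P Q S z 5
  | Zone_x : area P z S = area z Q S -> area z Q S = area P Q z -> zone P Q S z 6.

Lemma zone_uniq P Q S z i j : zone P Q S z i -> zone P Q S z j -> i = j.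
Proof.
by move=> zi zj; destruct zi; destruct zj; try reflexivity; exfalso; lra.
Qed.

(** The list is indexed by zones. Zone 6 falls on the empty default: no edge passes through the
    centroid. *)
Lemma tree_edges_zone sa sb sc ta tb tc P Q S e z : 0 < area P Q S ->
  e \in tree_edges (Node sa sb sc ta tb tc) P Q S -> on_edge e z ->
  let x := centroid P Q S in
  exists2 k, zone P Q S z k & e \in nth [::]
    [:: [:: (x, P, sa)]; [:: (x, Q, sb)]; [:: (x, S, sc)];
      tree_edges ta x Q S; tree_edges tb P x S; tree_edges tc P Q x] k.
Proof.
move=> PQS /=; have [ea eb ec] := area_centroid P Q S.
rewrite !inE !mem_cat; case/predU1P => [->|].
  by case/on_edge_a => // *; exists 0%N; [exact: Zone_a | rewrite inE].
case/predU1P => [->|].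
  by case/on_edge_b => // *; exists 1%N; [exact: Zone_b | rewrite inE].
case/predU1P => [->|].
  by case/on_edge_c => // *; exists 2%N; [exact: Zone_c | rewrite inE].
case/or3P => h on.
- exists 3%N => //; have := tree_edges_in _ h on.
  by case/(_ _)/in_triangle_a => [|*]; [lra | exact: Zone_ta].
- exists 4%N => //; have := tree_edges_in _ h on.
  by case/(_ _)/in_triangle_b => [|*]; [lra | exact: Zone_tb].
- exists 5%N => //; have := tree_edges_in _ h on.
  by case/(_ _)/in_triangle_c => [|*]; [lra | exact: Zone_tc].
Qed.

Lemma tree_points_zone sa sb sc ta tb tc P Q S z : 0 < area P Q S ->
  z \in tree_points (Node sa sb sc ta tb tc) P Q S ->
  let x := centroid P Q S in
  exists2 k, zone P Q S z k & z \in nth [::]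
    [:: [::]; [::]; [::];
      tree_points ta x Q S; tree_points tb P x S; tree_points tc P Q x; [:: x]] k.
Proof.
move=> PQS /=; have [ea eb ec] := area_centroid P Q S.
rewrite inE !mem_cat => /predU1P[->|/or3P[] h].
- by exists 6%N; [apply: Zone_x; lra | rewrite inE].
- exists 3%N => //; have := tree_points_in _ h.
  by case/(_ _)/in_triangle_a => [|*]; [lra | exact: Zone_ta].
- exists 4%N => //; have := tree_points_in _ h.
  by case/(_ _)/in_triangle_b => [|*]; [lra | exact: Zone_tb].
- exists 5%N => //; have := tree_points_in _ h.
  by case/(_ _)/in_triangle_c => [|*]; [lra | exact: Zone_tc].
Qed.

(** A common point has only one zone, so both edges are the same edge at the centroid or belong to
    the same small triangle. Equality includes the sign. *)
Lemma tree_edges_disjoint t P Q S e e' z : 0 < area P Q S ->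
  e \in tree_edges t P Q S -> e' \in tree_edges t P Q S ->
  on_edge e z -> on_edge e' z -> e = e'.
Proof.
elim: t P Q S => // sa sb sc ta IHa tb IHb tc IHc P Q S PQS he he' on on'.
have [k zk] := tree_edges_zone PQS he on.
have [k' zk'] := tree_edges_zone PQS he' on'.
have [ea eb ec] := area_centroid P Q S.
rewrite -(zone_uniq zk zk'); move: k {zk zk'} => [|[|[|[|[|[|[|k]]]]]]] //=.
- by rewrite !inE => /eqP -> /eqP.
- by rewrite !inE => /eqP -> /eqP.
- by rewrite !inE => /eqP -> /eqP.
- by move=> *; apply: (IHa (centroid P Q S) Q S) => //; lra.
- by move=> *; apply: (IHb P (centroid P Q S) S) => //; lra.
- by move=> *; apply: (IHc P Q (centroid P Q S)) => //; lra.
Qed.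

Lemma tree_points_off t P Q S e z : 0 < area P Q S ->
  z \in tree_points t P Q S -> e \in tree_edges t P Q S -> ~ on_edge e z.
Proof.
elim: t P Q S => // sa sb sc ta IHa tb IHb tc IHc P Q S PQS hz he on.
have [k zk] := tree_edges_zone PQS he on.
have [k' zk'] := tree_points_zone PQS hz.
have [ea eb ec] := area_centroid P Q S.
rewrite -(zone_uniq zk zk'); move: k {zk zk'} => [|[|[|[|[|[|[|k]]]]]]] //=.
- by move=> h h'; apply: (IHa (centroid P Q S) Q S) on => //; lra.
- by move=> h h'; apply: (IHb P (centroid P Q S) S) on => //; lra.
- by move=> h h'; apply: (IHc P Q (centroid P Q S)) on => //; lra.
Qed.

Lemma tree_edges_ends t P Q S e : 0 < area P Q S -> e \in tree_edges t P Q S ->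
  [/\ e.1.1 \in [:: P, Q, S & tree_points t P Q S],
     e.1.2 \in [:: P, Q, S & tree_points t P Q S] & e.1.1 <> e.1.2].
Proof.
elim: t P Q S => //= sa sb sc ta IHa tb IHb tc IHc P Q S PQS.
have [ea eb ec] := area_centroid P Q S.
set x := centroid P Q S in ea eb ec *.
have nx : [/\ x <> P, x <> Q & x <> S].
  by split=> E; move: ea eb ec PQS; rewrite E /area; lra.
case: nx => nP nQ nS; rewrite !inE.
case/predU1P => [->|]; first by rewrite !eqxx !orbT.
case/predU1P => [->|]; first by rewrite !eqxx !orbT.
case/predU1P => [->|]; first by rewrite !eqxx !orbT.
rewrite !mem_cat => /or3P[/IHa|/IHb|/IHc] [|h1 h2 h3]; try lra;
  move: h1 h2; rewrite !inE => h1 h2; split=> //;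
  [move: h1|move: h2|move: h1|move: h2|move: h1|move: h2];
  by case/or4P => ->; rewrite ?orbT.
Qed.

(** * A tree drawn as a planar signified graph *)

Section Drawing.

Variable t : tree.

Let P : point := (0, 0).
Let Q : point := (1, 0).
Let S : point := (0, 1).

Let PQS : 0 < area P Q S.
Proof. by rewrite /area /=; lra. Qed.

Let E := tree_edges t P Q S.
(** Removing duplicates makes [pos] injective by construction. *)
Let pts := undup [:: P, Q, S & tree_points t P Q S].
Let W := 'I_(size pts).
Let pos (i : W) : point := nth P pts i.

Let link (s : bool) : rel W := fun i j =>
  ((pos i, pos j, s) \in E) || ((pos j, pos i, s) \in E).
Let adjW : rel W := fun i j => link false i j || link true i j.

Lemma pos_inj : injective pos.
Proof.
move=> i j h; apply/val_inj/eqP.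
by rewrite -(nth_uniq P (ltn_ord i) (ltn_ord j)) ?undup_uniq //; apply/eqP.
Qed.

Lemma pos_off e i : e \in E -> ~ on_edge e (pos i).
Proof.
move=> he on; have := mem_nth P (ltn_ord i); rewrite -/(pos i) mem_undup.
rewrite -[in X in X -> _](cat1s P) -[in X in X -> _](cat1s Q) -[in X in X -> _](cat1s S).
rewrite !catA mem_cat => /orP[/corners_outside|].
  by apply; apply: tree_edges_in PQS he on.
by move/tree_points_off => /(_ e PQS he).
Qed.

Lemma segmentC (p q : point) u : segment p q u = segment q p (1 - u).
Proof. by rewrite /segment; congr pair; ring. Qed.

Lemma link_on s i j u : link s i j -> in01o u -> exists2 e, e \in E &
  [/\ on_edge e (segment (pos i) (pos j) u), e.2 = s
    & e.1 = (pos i, pos j) \/ e.1 = (pos j, pos i)].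
Proof.
move=> /orP[] h u01.
  by exists (pos i, pos j, s) => //; split=> //; [exists u | left].
exists (pos j, pos i, s) => //; split=> //; last by right.
by exists (1 - u); [case: u01; split; lra | rewrite segmentC].
Qed.

Lemma half_in : in01o (1 / 2).
Proof. by split; lra. Qed.

(** Two links of different signs would be two listed edges sharing the midpoint. *)
Lemma link_sign s s' i j : link s i j -> link s' i j -> s = s'.
Proof.
move=> /(@link_on _ _ _ (1 / 2))/(_ half_in)[e he [on <- _]].
move=> /(@link_on _ _ _ (1 / 2))/(_ half_in)[e' he' [on' <- _]].
by rewrite (tree_edges_disjoint PQS he he' on on').
Qed.

Lemma linkC s i j : link s i j = link s j i.
Proof. by rewrite /link orbC. Qed.

Lemma link_neq s i j : link s i j -> pos i <> pos j.
Proof. by move=> /orP[] /(tree_edges_ends PQS)[_ _] //= h /esym. Qed.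

Lemma adjW_link i j : adjW i j -> exists s, link s i j.
Proof. by case/orP; [exists false | exists true]. Qed.

Lemma stacked_signified : signified adjW (link true).
Proof.
split=> [i j|i|i j|i j h].
- by rewrite /adjW !(linkC _ i).
- by apply/negP => /adjW_link[s /link_neq].
- exact: linkC.
- by rewrite /adjW h orbT.
Qed.

Lemma affine_continuity a b u : continuity_pt (fun v => a + v * b) u.
Proof. by apply: derivable_continuous_pt; reg. Qed.

Lemma stacked_planar : planar adjW.
Proof.
exists (fun i => (pos i).1), (fun i => (pos i).2).
exists (fun i j u => (segment (pos i) (pos j) u).1).
exists (fun i j u => (segment (pos i) (pos j) u).2).
have pairE (p q : point) : p.1 = q.1 -> p.2 = q.2 -> p = q.
  by case: p q => [a b] [c d] /= -> ->.
split; [|split].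
- by move=> i j h1 h2; apply/pos_inj/pairE.
- move=> i j /adjW_link[s lij]; rewrite /segment /=.
  do 4 (split; first by ring).
  split; [|split].
  + by move=> u _; split; apply: affine_continuity.
  + move=> u v _ _ h1 h2; have nij := link_neq lij.
    have [//|nuv] := Req_dec u v; case: nij.
    have nuv' : u - v <> 0 by lra.
    by apply: pairE; apply: (Rmult_eq_reg_l (u - v)) => //; lra.
  + move=> u k u01 [h1 h2].
    have [e he [on _ _]] := link_on lij u01.
    apply: (pos_off (i := k) he); suff -> : pos k = segment (pos i) (pos j) u by [].
    by apply: pairE.
- move=> i j i' j' /adjW_link[s lij] /adjW_link[s' lij'] neq u v u01 v01 [h1 h2].
  have [e he [on _ e1]] := link_on lij u01.
  have [e' he' [on' _ e1']] := link_on lij' v01.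
  have E12 : segment (pos i) (pos j) u = segment (pos i') (pos j') v by apply: pairE.
  rewrite -E12 in on'; have ee := tree_edges_disjoint PQS he he' on on'.
  subst e'; apply: neq; case: e1 e1' => -> [] [/pos_inj -> /pos_inj ->];
  by rewrite !eqxx ?orbT.
Qed.

Lemma tree_edges_pos e : e \in E ->
  exists i j : W, e.1 = (pos i, pos j).
Proof.
have ex p : p \in [:: P, Q, S & tree_points t P Q S] -> exists i : W, p = pos i.
  rewrite -mem_undup => /(nthP P)[i hi <-].
  by exists (Ordinal hi).
case/(tree_edges_ends PQS) => /ex[i hi] /ex[j hj] _.
by exists i, j; rewrite -hi -hj; case: (e.1).
Qed.

Lemma stacked_realizes (T : finType) (adj neg : rel T) (f : W -> T) :
  sig_hom adjW (link true) adj neg f -> exists A B C, realizes adj neg t A B C.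
Proof.
move=> hom; have P_in : (0 < size pts)%N.
  by rewrite -has_predT; apply/hasP; exists P => //; rewrite mem_undup mem_head.
(* Carries [f] from indices to points, with an arbitrary value off the vertices, so that the
   induction on the tree can run over triangles. *)
pose F p := f (odflt (Ordinal P_in) [pick i | pos i == p]).
have FE i : F (pos i) = f i.
  rewrite /F; case: pickP => [j /eqP/pos_inj -> //|/(_ i)].
  by rewrite eqxx.
have edgeF p q s : (p, q, s) \in E -> signed_edge adj neg s (F p) (F q).
  move=> h; have [i [j [pi qj]]] := tree_edges_pos h; subst p q.
  have lij : link s i j by rewrite /link h.
  have [|h1 h2] := hom i j; first by rewrite /adjW; case: (s) lij => ->; rewrite ?orbT.
  rewrite !FE /signed_edge h1 h2; case: s lij {h} => lij; first by rewrite lij.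
  by apply/eqP/negbTE/negP => /(link_sign lij).
exists (F P), (F Q), (F S).
move: edgeF; rewrite /E.
elim: (t) P Q S => //= sa sb sc ta IHa tb IHb tc IHc p q r edgeF.
apply/existsP; exists (F (centroid p q r)).
rewrite !edgeF ?inE ?eqxx ?orbT //=.
apply/and3P; split; [apply: IHa|apply: IHb|apply: IHc] => a b c h;
  by apply: edgeF; rewrite !inE !mem_cat h !orbT.
Qed.

End Drawing.

End StackedTriangulation.

(** * Assembling the isomorphism *)

Lemma bound_realizes (T : finType) (adj neg : rel T) :
  (forall (W : finType) (adjW negW : rel W),
      signified adjW negW -> planar adjW ->
      exists f : W -> T, sig_hom adjW negW adj neg f) ->
  forall t, exists A B C, realizes adj neg t A B C.
Proof.
move=> bound t.
have [f hom] := bound _ _ _ (@stacked_signified t) (@stacked_planar t).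
exact: stacked_realizes hom.
Qed.

Theorem mainTheorem15 (V : finType) (adj neg : rel V) :
  signified adj neg ->
  #|V| = 20 ->
  anti_twinned adj neg ->
  (forall (W : finType) (adjW negW : rel W),
      signified adjW negW -> planar adjW ->
      exists f : W -> V, sig_hom adjW negW adj neg f) ->
  exists f : V -> TrSP9, sig_iso adj neg TrSP9_adj TrSP9_neg f.
Proof.
move=> _ cardV [H [adjH [negH [h [sigH [h_bij h_iso]]]]]] bound.
have cardH : #|H| = 10.
  by have := bij_eq_card h_bij; rewrite cardV card_prod card_bool; lia.
have real : forall t, exists A B C,
    realizes (AT_adj adjH) (AT_neg adjH negH) t A B C.
  apply: bound_realizes => W adjW negW sigW planarW.
  have [f hom] := bound W adjW negW sigW planarW.
  exists (h \o f) => x y /hom[e1 e2].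
  by have [-> ->] := h_iso (f x) (f y).
have [good [[A0 [B0 g0]] good_cell]] :=
  universal_edges (AT_signified sigH) real.
have reg : regular adjH negH.
  move=> A B AB; split; first exact: (adj_all sigH cardH good_cell g0 AB).
  by move=> sa sb; exact: (cell_card sigH cardH good_cell sa sb g0 AB).
have [k [k_bij k_iso]] := regular_iso sigH cardH reg.
exists (k \o h); split; first exact: bij_comp.
move=> x y; have [<- <-] := h_iso x y.
exact: k_iso.
Qed.
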